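(* Let $A = \begin{pmatrix} 1 & 1 \\ 1 & -1 \end{pmatrix}$ and let $1 \le p \le \infty$. Then $$\|A\|_{p \to p} = \max\left(2^{1/p},\, 2^{1-1/p}\right).$$ In particular, $\|A\|_{p\to p} = 2^{1/p}$ for $p \in [1,2]$, and $\|A\|_{p\to p} = 2^{1-1/p}$ for $p \in [2,\infty]$.
   Context: $\|A\|_{p\to p} = \sup_{v \ne 0} \|Av\|_p/\|v\|_p$ denotes the operator norm of $A$ on two-dimensional $\ell_p$ (i.e. $\mathbb{R}^2$ with the norm $\|v\|_p = (|v_1|^p+|v_2|^p)^{1/p}$ for $p<\infty$ and $\|v\|_\infty = \max(|v_1|,|v_2|)$). The convention $1/\infty = 0$ is used. *)

(* Defs.v *)
From HB Require Import structures.
From mathcomp Require Import all_boot all_order all_algebra.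
From mathcomp Require Import all_classical all_reals all_analysis.
Set Implicit Arguments.
Unset Strict Implicit.
Unset Printing Implicit Defensive.
Import Order.TTheory GRing.Theory Num.Theory.
Local Open Scope classical_set_scope.
Local Open Scope ring_scope.

(* Only exponents 1 <= p <= +oo are meaningful; the value at -oo is a dummy. *)
Definition lpnorm (R : realType) (n : nat) (p : \bar R) (v : 'cV[R]_n) : R :=
  match p with
  | r%:E => (\sum_(i < n) `|v i ord0| `^ r) `^ r^-1
  | +oo%E => \big[Num.max/0]_(i < n) `|v i ord0|
  | -oo%E => 0
  end.

(* The supremum is taken in \bar R, where it always exists; [sup] on R would
   return a default value on an unbounded set. *)
Definition lp_opnorm (R : realType) (m n : nat) (p : \bar R) (A : 'M[R]_(m, n))
    : \bar R :=
  ereal_sup [set (lpnorm p (A *m v) / lpnorm p v)%:E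
            | v in [set v : 'cV[R]_n | v != 0]].

(* The inverse of \bar R satisfies +oo^-1 = 0, hence inv_exponent +oo = 0. *)
Definition inv_exponent (R : realType) (p : \bar R) : R := fine (p^-1)%E.

Definition hadamard2 (R : realType) : 'M[R]_2 :=
  \matrix_(i < 2, j < 2) (if (i == 1) && (j == 1) then -1 else 1).

(* Main.v *)
Require Import Defs.
From HB Require Import structures.
From mathcomp Require Import all_boot all_order all_algebra.
From mathcomp Require Import all_classical all_reals all_analysis.
From mathcomp Require Import ring lra.
Set Implicit Arguments.
Unset Strict Implicit.
Unset Printing Implicit Defensive.
Import Order.TTheory GRing.Theory Num.Theory.
Local Open Scope classical_set_scope.
Local Open Scope ring_scope.

(** The parallelogram law |x+y|^2 + |x-y|^2 = 2 (x^2 + y^2) turns both bounds on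
    |x+y|^p + |x-y|^p into comparisons of power sums of exponent s = p/2.
    For s <= 1, concavity of t^s and its subadditivity give 2 (|x|^p + |y|^p);
    for s >= 1, superadditivity and convexity give 2^(p-1) (|x|^p + |y|^p).
    The vectors (1,0) and (1,1) are respectively extremal. *)

Lemma powR_midpoint_le (R : realType) (s a b : R) : 1 <= s -> 0 <= a -> 0 <= b ->
  ((a + b) / 2) `^ s <= (a `^ s + b `^ s) / 2.
Proof.
move=> s1 a0 b0.
have h : 0 <= 2^-1 :> R by lra.
have h1 : 2^-1 <= 1 :> R by lra.
have midE (u v : R) : (u + v) / 2 = 2^-1 * u + (1 - 2^-1) * v by lra.
rewrite !midE; apply: (convex_powR s1 (Itv01 h h1));
  by rewrite inE /= in_itv /= andbT.
Qed.

(** Write [t ^ s = t * t ^ (s - 1)]; since [s - 1 >= 0], the second factor at [a] or at [b] is at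
    most its value at [a + b]. *)
Lemma powR_superadditive (R : realType) (s a b : R) :
  1 <= s -> 0 <= a -> 0 <= b -> a `^ s + b `^ s <= (a + b) `^ s.
Proof.
move=> s1 a0 b0; have s0 : 0 < s by lra.
have ab0 : 0 <= a + b by lra.
rewrite -(mulr_powRB1 a0 s0) -(mulr_powRB1 b0 s0) -(mulr_powRB1 ab0 s0) mulrDl
   lerD// ler_wpM2l// ge0_ler_powR ?nnegrE//; lra.
Qed.

Lemma powRK (R : realType) (s a : R) : s != 0 -> 0 <= a -> (a `^ s) `^ s^-1 = a.
Proof. by move=> s0 a0; rewrite -powRrM mulfV// powRr1. Qed.

(** Dual to [powR_midpoint_le]: apply that lemma with exponent [s^-1 >= 1] to [a ^ s] and [b ^ s],
    then raise both sides to the power [s]. *)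
Lemma powR_midpoint_ge (R : realType) (s a b : R) :
  0 < s -> s <= 1 -> 0 <= a -> 0 <= b ->
  (a `^ s + b `^ s) / 2 <= ((a + b) / 2) `^ s.
Proof.
move=> s0 s1 a0 b0.
have := @powR_midpoint_le R s^-1 (a `^ s) (b `^ s).
rewrite invf_ge1// => /(_ s1 (powR_ge0 _ _) (powR_ge0 _ _)).
rewrite !powRK ?gt_eqF// => /(ge0_ler_powR (ltW s0)).
rewrite !nnegrE powR_ge0 -powRrM mulVf ?gt_eqF// powRr1.
  by apply=> //; lra.
by rewrite divr_ge0// addr_ge0// powR_ge0.
Qed.

(** The same inversion of the exponent, now starting from [powR_superadditive]. *)
Lemma powR_subadditive (R : realType) (s a b : R) :
  0 < s -> s <= 1 -> 0 <= a -> 0 <= b -> (a + b) `^ s <= a `^ s + b `^ s.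
Proof.
move=> s0 s1 a0 b0.
have := @powR_superadditive R s^-1 (a `^ s) (b `^ s).
rewrite invf_ge1// => /(_ s1 (powR_ge0 _ _) (powR_ge0 _ _)).
rewrite !powRK ?gt_eqF// => /(ge0_ler_powR (ltW s0)).
rewrite !nnegrE powR_ge0 -powRrM mulVf ?gt_eqF// powRr1.
  by apply=> //; lra.
by rewrite addr_ge0// powR_ge0.
Qed.

Lemma norm_powR_sqr (R : realType) (p x : R) : `|x| `^ p = (x ^+ 2) `^ (p / 2).
Proof.
by rewrite -(real_normK (num_real x)) -powR_mulrn// -powRrM mulrC divfK.
Qed.

Lemma parallelogram (R : realType) (x y : R) :
  (x + y) ^+ 2 + (x - y) ^+ 2 = 2 * (x ^+ 2 + y ^+ 2).
Proof. by ring. Qed.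

Lemma clarkson_le2 (R : realType) (p x y : R) : 0 < p -> p <= 2 ->
  `|x + y| `^ p + `|x - y| `^ p <= 2 * (`|x| `^ p + `|y| `^ p).
Proof.
move=> p0 p2; rewrite !norm_powR_sqr.
have s0 : 0 < p / 2 by lra.
have s1 : p / 2 <= 1 by lra.
(* By the parallelogram law, the midpoint of [(x + y) ^ 2] and [(x - y) ^ 2] is [x ^ 2 + y ^ 2]. *)
have := powR_midpoint_ge s0 s1 (sqr_ge0 (x + y)) (sqr_ge0 (x - y)).
rewrite parallelogram (mulrC 2) mulfK// => h.
have := powR_subadditive s0 s1 (sqr_ge0 x) (sqr_ge0 y).
lra.
Qed.

Lemma clarkson_ge2 (R : realType) (p x y : R) : 2 <= p ->
  `|x + y| `^ p + `|x - y| `^ p <= 2 `^ (p - 1) * (`|x| `^ p + `|y| `^ p).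
Proof.
move=> p2; rewrite !norm_powR_sqr.
have s1 : 1 <= p / 2 by lra.
have xy0 : 0 <= x ^+ 2 + y ^+ 2 by rewrite addr_ge0 ?sqr_ge0.
apply: le_trans (powR_superadditive s1 (sqr_ge0 _) (sqr_ge0 _)) _.
rewrite parallelogram.
(* Exposing the midpoint leaves a factor [4 ^ (p / 2) = 2 ^ p]; the halving in the convexity bound
   turns it into [2 ^ (p - 1)]. *)
have -> : 2 * (x ^+ 2 + y ^+ 2) = 2 ^+ 2 * ((x ^+ 2 + y ^+ 2) / 2) by field.
rewrite powRM ?divr_ge0// -norm_powR_sqr normr_nat powRB ?powRr1 ?pnatr_eq0 ?implybT//.
rewrite -mulrA ler_wpM2l ?powR_ge0// [leRHS]mulrC.
exact: powR_midpoint_le s1 (sqr_ge0 _) (sqr_ge0 _).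
Qed.

Lemma lpnorm_ge0 (R : realType) (n : nat) (p : \bar R) (v : 'cV[R]_n) :
  0 <= lpnorm p v.
Proof. by case: p => [r||] //=; [exact: powR_ge0 | exact: bigmax_ge_id]. Qed.

(** An upper bound that is attained at some vector is the supremum; each case below only has to
    supply the bound and an extremal [w]. *)
Lemma lp_opnorm_eq (R : realType) (m n : nat) (p : \bar R) (A : 'M[R]_(m, n))
    (C : R) (w : 'cV[R]_n) :
  (forall v, lpnorm p (A *m v) <= C * lpnorm p v) ->
  0 < lpnorm p w -> w != 0 -> lpnorm p (A *m w) = C * lpnorm p w ->
  lp_opnorm p A = C%:E.
Proof.
move=> AC w0 wN0 Aw; apply/eqP; rewrite eq_le; apply/andP; split; last first.
  apply: ereal_sup_ubound; exists w => //=.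
  by rewrite Aw mulfK// gt_eqF.
(* The sign of [C] settles the case [lpnorm p v = 0], where the quotient is 0 because [0^-1 = 0]. *)
have C0 : 0 <= C by rewrite -(pmulr_lge0 _ w0) -Aw lpnorm_ge0.
apply: ge_ereal_sup => _ [v _ <-]; rewrite lee_fin.
have := lpnorm_ge0 p v; rewrite le_eqVlt => /predU1P[<-|v0].
  by rewrite invr0 mulr0.
by rewrite ler_pdivrMr.
Qed.

Lemma lpnorm2_fin (R : realType) (r : R) (v : 'cV[R]_2) :
  lpnorm r%:E v = (`|v 0 0| `^ r + `|v 1 0| `^ r) `^ r^-1.
Proof.
rewrite /= big_ord_recl big_ord1; congr ((_ + `|v _ _| `^ _) `^ _).
exact: val_inj.
Qed.

Lemma lpnorm2_pinfty (R : realType) (v : 'cV[R]_2) :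
  lpnorm +oo%E v = Num.max `|v 0 0| `|v 1 0|.
Proof.
rewrite /= big_ord_recl big_ord_recl big_ord0.
rewrite [Num.max _ 0]max_l//; congr (Num.max _ `|v _ _|); exact: val_inj.
Qed.

Lemma hadamard2_mul0 (R : realType) (v : 'cV[R]_2) :
  (hadamard2 R *m v) 0 0 = v 0 0 + v 1 0.
Proof.
rewrite mxE big_ord_recl big_ord1 !mxE /= !mul1r; congr (_ + v _ _).
exact: val_inj.
Qed.

Lemma hadamard2_mul1 (R : realType) (v : 'cV[R]_2) :
  (hadamard2 R *m v) 1 0 = v 0 0 - v 1 0.
Proof.
rewrite mxE big_ord_recl big_ord1 !mxE /= mul1r mulN1r; congr (_ - v _ _).
exact: val_inj.
Qed.

Lemma delta_col_neq0 (R : realType) : delta_mx 0 0 != 0 :> 'cV[R]_2.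
Proof.
by apply/eqP => /matrixP/(_ 0 0)/eqP; rewrite !mxE oner_eq0.
Qed.

Lemma const_col_neq0 (R : realType) : const_mx 1 != 0 :> 'cV[R]_2.
Proof.
by apply/eqP => /matrixP/(_ 0 0)/eqP; rewrite !mxE oner_eq0.
Qed.

Lemma lp_opnorm_hadamard2_le2 (R : realType) (r : R) : 1 <= r -> r <= 2 ->
  lp_opnorm r%:E (hadamard2 R) = (2 `^ r^-1)%:E.
Proof.
move=> r1 r2; have r0 : 0 < r by lra.
have rV0 : 0 <= r^-1 by rewrite invr_ge0 ltW.
have N1 : lpnorm r%:E (delta_mx 0 0 : 'cV[R]_2) = 1.
  by rewrite lpnorm2_fin !mxE /= normr1 normr0 powR1 powR0 ?gt_eqF// addr0 powR1.
apply: (@lp_opnorm_eq _ _ _ _ _ _ (delta_mx 0 0)).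
- move=> v; rewrite !lpnorm2_fin hadamard2_mul0 hadamard2_mul1.
  (* With the constant moved under the power [r^-1], monotonicity of that power reduces the bound to
     [clarkson_le2]. *)
  rewrite -powRM ?addr_ge0 ?powR_ge0//.
  by rewrite ge0_ler_powR ?nnegrE ?mulr_ge0 ?addr_ge0 ?powR_ge0// clarkson_le2.
- by rewrite N1.
- exact: delta_col_neq0.
- rewrite N1 mulr1 lpnorm2_fin hadamard2_mul0 hadamard2_mul1 !mxE /=.
  by rewrite addr0 subr0 normr1 powR1.
Qed.

Lemma lp_opnorm_hadamard2_ge2 (R : realType) (r : R) : 2 <= r ->
  lp_opnorm r%:E (hadamard2 R) = (2 `^ (1 - r^-1))%:E.
Proof.
move=> r2; have r0 : 0 < r by lra.
have rV0 : 0 <= r^-1 by rewrite invr_ge0 ltW.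
have N1 : lpnorm r%:E (const_mx 1 : 'cV[R]_2) = 2 `^ r^-1.
  by rewrite lpnorm2_fin !mxE normr1 powR1.
(* This form lets the constant merge with the power sum, as [clarkson_ge2] requires. *)
have CE : 2 `^ (1 - r^-1) = (2 `^ (r - 1)) `^ r^-1.
  by rewrite -powRrM mulrBl mulfV ?gt_eqF// mul1r.
apply: (@lp_opnorm_eq _ _ _ _ _ _ (const_mx 1)).
- move=> v; rewrite !lpnorm2_fin hadamard2_mul0 hadamard2_mul1 CE.
  rewrite -powRM ?addr_ge0 ?powR_ge0//.
  by rewrite ge0_ler_powR ?nnegrE ?mulr_ge0 ?addr_ge0 ?powR_ge0// clarkson_ge2.
- by rewrite N1 powR_gt0.
- exact: const_col_neq0.
(* The exponents [1 - r^-1] and [r^-1] add up to 1, and the image of (1,1) is (2,0), of norm 2. *)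
- rewrite N1 -powRD ?pnatr_eq0 ?implybT// subrK.
  rewrite lpnorm2_fin hadamard2_mul0 hadamard2_mul1 !mxE.
  rewrite subrr normr0 powR0 ?gt_eqF// addr0 -[1 + 1]/(2%:R) normr_nat.
  by rewrite powRK ?gt_eqF// powRr1.
Qed.

Lemma lp_opnorm_hadamard2_pinfty (R : realType) :
  lp_opnorm +oo%E (hadamard2 R) = 2%:E.
Proof.
have N1 : lpnorm +oo%E (const_mx 1 : 'cV[R]_2) = 1.
  by rewrite lpnorm2_pinfty !mxE normr1 maxxx.
apply: (@lp_opnorm_eq _ _ _ _ _ _ (const_mx 1)).
- move=> v; rewrite !lpnorm2_pinfty hadamard2_mul0 hadamard2_mul1.
  set x := v 0 0; set y := v 1 0.
  (* The triangle inequality suffices here: both [|x + y|] and [|x - y|] are at most [|x| + |y|],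
     hence at most twice the maximum. *)
  have hx : `|x| <= Num.max `|x| `|y| by rewrite le_max lexx.
  have hy : `|y| <= Num.max `|x| `|y| by rewrite le_max lexx orbT.
  have := ler_normD x y; have := ler_normB x y.
  by rewrite ge_max => h1 h2; apply/andP; split; lra.
- by rewrite N1.
- exact: const_col_neq0.
- rewrite N1 lpnorm2_pinfty hadamard2_mul0 hadamard2_mul1 !mxE.
  by rewrite subrr normr0 -[1 + 1]/(2%:R) normr_nat mulr1 max_l.
Qed.

Theorem lemma3p2 (R : realType) (p : \bar R) (hp : (1 <= p)%E) :
  [/\ lp_opnorm p (hadamard2 R) =
        (Num.max (2 `^ inv_exponent p) (2 `^ (1 - inv_exponent p)))%:E,
      (p <= 2%:E)%E ->
        lp_opnorm p (hadamard2 R) = (2 `^ inv_exponent p)%:E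
    & (2%:E <= p)%E ->
        lp_opnorm p (hadamard2 R) = (2 `^ (1 - inv_exponent p))%:E].
Proof.
(* The comparison of the exponent with 1/2 is carried along because it decides which of the two
   powers of 2 is the maximum. *)
have le2 : (p <= 2%:E)%E ->
    lp_opnorm p (hadamard2 R) = (2 `^ inv_exponent p)%:E /\
    2^-1 <= inv_exponent p.
  case: p hp => [r| |] //; rewrite ?lee_fin => r1 r2.
  have r0 : 0 < r by rewrite (lt_le_trans _ r1).
  by rewrite /inv_exponent fine_invr lp_opnorm_hadamard2_le2// lef_pV2 ?posrE.
have ge2 : (2%:E <= p)%E ->
    lp_opnorm p (hadamard2 R) = (2 `^ (1 - inv_exponent p))%:E /\
    inv_exponent p <= 2^-1.
  case: p hp {le2} => [r| |] //; rewrite ?lee_fin => r1 r2.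
    have r0 : 0 < r by rewrite (lt_le_trans _ r1).
    by rewrite /inv_exponent fine_invr lp_opnorm_hadamard2_ge2// lef_pV2 ?posrE.
  (* At [p = +oo] the inverse exponent is 0, so the claimed value is [2 ^ 1]. *)
  by rewrite /inv_exponent invey /= subr0 powRr1// lp_opnorm_hadamard2_pinfty.
split=> [|/le2[]//|/ge2[]//].
have [/le2[-> i2]|/ltW /ge2[-> i2]] := leP p 2%:E.
- by rewrite max_l// ler_powR ?ler1n//; lra.
- by rewrite max_r// ler_powR ?ler1n//; lra.
Qed.
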